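(* Suppose that $G_n$, $n\ge1$, are graphs with $v(G_n)\to\infty$ and that $G_n\to\Gamma\in\mathcal U_\infty$ as $n\to\infty$. (i) If $\Gamma$ is connected, then for every $\delta>0$ there exists $\varepsilon>0$ such that, for all large $n$, if $V(G_n)=V'\cup V''$ is a partition with $|V'|,|V''|\ge\delta v(G_n)$, then $e(V',V'')\ge\varepsilon v(G_n)^2$. (ii) If $\Gamma$ is disconnected, then there exist $\delta>0$ and, for all large $n$, a partition $V(G_n)=V'\cup V''$ (depending on $n$) with $|V'|,|V''|\ge\delta v(G_n)$ such that $e(V',V'')=o\bigl(v(G_n)^2\bigr)$ as $n\to\infty$.
   Context: Graphs are finite, simple, undirected, with at least one vertex; $v(G)=|V(G)|$, $e(G)=|E(G)|$. For $V',V''\subseteq V(G)$, $e(V',V'')=e_G(V',V'')=|\{ij\in E(G): i\in V',\,j\in V''\}|$. Graph limits. For graphs $F,G$, $t(F,G)$ is the probability that a uniformly random map $V(F)\to V(G)$ is a graph homomorphism (maps edges to edges). The set $\mathcal U$ of unlabelled graphs (isomorphism classes) is embedded as a dense subset of a compact metric space $\overline{\mathcal U}$; the elements of $\mathcal U_\infty=\overline{\mathcal U}\setminus\mathcal U$ are called graph limits, and $v(\Gamma)=\infty$ for $\Gamma\in\mathcal U_\infty$. Each $t(F,\cdot)$ extends continuously to $\overline{\mathcal U}$; a graph limit $\Gamma$ is determined by the numbers $t(F,\Gamma)$, $F$ ranging over all graphs; and a sequence $G_n$ in $\overline{\mathcal U}$ converges to $\Gamma\in\mathcal U_\infty$ iff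 $v(G_n)\to\infty$ and $t(F,G_n)\to t(F,\Gamma)$ for every graph $F$. (Concretely, graph limits can be identified with the families $(t_F)_F$ arising as $t_F=\lim_n t(F,G_n)$ for sequences of graphs with $v(G_n)\to\infty$ for which all these limits exist.) Connectedness. For $\Gamma_1,\Gamma_2\in\mathcal U_\infty$ and $\alpha\in[0,1]$, $\alpha\Gamma_1\oplus(1-\alpha)\Gamma_2$ is the unique graph limit $\Gamma$ with $t(F,\Gamma)=\alpha^{v(F)}t(F,\Gamma_1)+(1-\alpha)^{v(F)}t(F,\Gamma_2)$ for every connected graph $F$. A graph limit $\Gamma$ is disconnected if there exist $\Gamma_1,\Gamma_2\in\mathcal U_\infty$ and $\alpha\in(0,1)$ with $\Gamma=\alpha\Gamma_1\oplus(1-\alpha)\Gamma_2$; otherwise it is connected. *)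

(* Defs.v *)
From HB Require Import structures.
From mathcomp Require Import all_boot all_order all_algebra.
From mathcomp Require Import all_classical all_reals all_analysis.

Set Implicit Arguments.
Unset Strict Implicit.
Unset Printing Implicit Defensive.

Import Order.TTheory GRing.Theory Num.Theory.
Import numFieldNormedType.Exports.

Local Open Scope classical_set_scope.
Local Open Scope ring_scope.

Record graph := Graph {
  vertex :> finType;
  adj : rel vertex;
  adj_sym : symmetric adj;
  adj_irr : irreflexive adj;
  vertex_gt0 : (0 < #|vertex|)%N }.

Definition v (G : graph) : nat := #|G|.

(* Edges are unordered pairs, so an edge inside V' :&: V'' counts once. *)
Definition edges_between (G : graph) (V' V'' : {set G}) : nat :=
  #|[set [set i; j] | i in V', j in V'' & adj i j]%SET|.

Definition is_partition (G : graph) (V' V'' : {set G}) : bool :=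
  (V' :|: V'' == [set: G])%SET && [disjoint V' & V''].

Definition is_hom (F G : graph) (f : {ffun F -> G}) : bool :=
  [forall x, forall y, adj x y ==> adj (f x) (f y)].

Definition t (R : realType) (F G : graph) : R :=
  #|[set f : {ffun F -> G} | is_hom f]%SET|%:R / #|{ffun F -> G}|%:R.

Definition connected_graph (F : graph) : bool :=
  [forall x : F, forall y : F, connect (@adj F) x y].

(* A graph limit is identified with its family of homomorphism densities. *)
Record graph_limit (R : realType) := GraphLimit {
  tlim : graph -> R;
  tlimP : exists G : nat -> graph,
    (v (G n) @[n --> \oo] --> \oo) /\
    (forall F : graph, t R F (G n) @[n --> \oo] --> tlim F) }.

Definition converges_to (R : realType) (G : nat -> graph)
    (Gamma : graph_limit R) : Prop :=
  (v (G n) @[n --> \oo] --> \oo) /\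
  (forall F : graph, t R F (G n) @[n --> \oo] --> tlim Gamma F).

(* Gamma = alpha Gamma1 (+) (1 - alpha) Gamma2; homomorphism densities are
   multiplicative over components, so connected F determine Gamma. *)
Definition is_dsum (R : realType) (alpha : R)
    (Gamma1 Gamma2 Gamma : graph_limit R) : Prop :=
  forall F : graph, connected_graph F ->
    tlim Gamma F = alpha ^+ v F * tlim Gamma1 F
                 + (1 - alpha) ^+ v F * tlim Gamma2 F.

Definition disconnected_limit (R : realType) (Gamma : graph_limit R) : Prop :=
  exists (Gamma1 Gamma2 : graph_limit R) (alpha : R),
    0 < alpha < 1 /\ is_dsum alpha Gamma1 Gamma2 Gamma.

Definition connected_limit (R : realType) (Gamma : graph_limit R) : Prop :=
  ~ disconnected_limit Gamma.

(* Main.v *)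
Require Import Defs.
From HB Require Import structures.
From mathcomp Require Import all_boot all_order all_algebra.
From mathcomp Require Import all_classical all_reals all_analysis.
From mathcomp Require Import ring lra zify.

Import Order.TTheory GRing.Theory Num.Theory.
Import numFieldNormedType.Exports.

Local Open Scope classical_set_scope.
Local Open Scope ring_scope.

Set Implicit Arguments.
Unset Strict Implicit.
Unset Printing Implicit Defensive.

(** (i) Suppose that infinitely many [G n] have a partition with both parts of
    proportion at least [delta] and crossing density tending to 0. Deleting
    the crossing edges moves [t F] by at most [#|F| ^ 2] times the cut density
    ([sever_error]), and it leaves the disjoint union of two induced
    subgraphs, on which the density of a connected [F] is exactly the
    expression that defines a direct sum ([avg_sever]). Along a diagonal
    subsequence ([diagonal_subsequence]) both induced subgraphs converge, so
    the limit is a direct sum, i.e. disconnected.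

    (ii) The cut is found by exploring the graph from a random vertex; only
    densities of connected graphs enter. Sample vertices [z 0, z 1, ..., z N]
    uniformly and let [R_0] be the neighbourhood of [z 0] and
    [R_(j+1) = R_j] together with the neighbours of [z (j+1)] if
    [z (j+1)] lies in [R_j], and [R_(j+1) = R_j] otherwise ([reach]). Let
    [missed] be the event that a sample [u] is adjacent to [z 0] while another
    sample [y] lies outside [R_N].

    The indicator of [missed] is a linear combination of products of adjacency
    indicators whose edges form a connected graph through [z 0]
    ([missed_spanned]). So its probability has the same limit in [G n] as in a
    weighted disjoint union of graphs converging to the two summands of
    [Gamma] ([spanned_limit]). There [R_N] never leaves the summand of
    [z 0], which bounds the probability from below, uniformly in [N], by
    [min alpha (1 - alpha)] times the edge density ([missed_lower]).

    In [G n], the expected growth of the vertex density from [R_j] to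
    [R_(j+1)] is exactly the expected density of edges leaving [R_j]
    ([avg_reach_step]). The total growth is at most 1, so on average over [j]
    that cut density is at most [1 / N], whereas the probability of [missed]
    keeps both [R_j] and its complement large. Hence some outcome is a
    balanced cut of density [O(1 / N)] ([exists_cut]). If the limit edge
    density is 0, every partition into halves is sparse. Taking in each
    [G n] the sparsest balanced partition finishes the proof. *)

(** * Averages over independent weighted samples *)

(** The expectation of [phi] when the coordinates [f i] are independent with
    common law [mu]. *)
Definition avg (R : realType) (V I : finType) (mu : V -> R)
    (phi : {ffun I -> V} -> R) : R :=
  \sum_(f : {ffun I -> V}) (\prod_i mu (f i)) * phi f.

Definition upd (V I : finType) (f : {ffun I -> V}) (i : I) (w : V) :
    {ffun I -> V} :=
  [ffun k => if k == i then w else f k].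

Lemma upd_same (V I : finType) (f : {ffun I -> V}) i w : upd f i w i = w.
Proof. by rewrite ffunE eqxx. Qed.

Lemma upd_other (V I : finType) (f : {ffun I -> V}) i w k :
  k != i -> upd f i w k = f k.
Proof. by move=> /negbTE ki; rewrite ffunE ki. Qed.

Lemma eq_avg (R : realType) (V I : finType) (mu : V -> R)
    (phi psi : {ffun I -> V} -> R) :
  phi =1 psi -> avg mu phi = avg mu psi.
Proof. by move=> E; apply: eq_bigr => f _; rewrite E. Qed.

Lemma le_avg (R : realType) (V I : finType) (mu : V -> R)
    (phi psi : {ffun I -> V} -> R) :
  (forall w, 0 <= mu w) -> (forall f, phi f <= psi f) ->
  avg mu phi <= avg mu psi.
Proof.
move=> mu0 E; apply: ler_sum => f _.
by apply: ler_wpM2l => //; apply: prodr_ge0.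
Qed.

Lemma avgD (R : realType) (V I : finType) (mu : V -> R)
    (phi psi : {ffun I -> V} -> R) :
  avg mu (fun f => phi f + psi f) = avg mu phi + avg mu psi.
Proof. by rewrite /avg -big_split; apply: eq_bigr => f _; rewrite mulrDr. Qed.

Lemma avgZ (R : realType) (V I : finType) (mu : V -> R) (c : R)
    (phi : {ffun I -> V} -> R) :
  avg mu (fun f => c * phi f) = c * avg mu phi.
Proof. by rewrite /avg mulr_sumr; apply: eq_bigr => f _; rewrite mulrCA. Qed.

Lemma avgB (R : realType) (V I : finType) (mu : V -> R)
    (phi psi : {ffun I -> V} -> R) :
  avg mu (fun f => phi f - psi f) = avg mu phi - avg mu psi.
Proof.
rewrite -mulN1r -avgZ -avgD; apply: eq_avg => f.
by rewrite mulN1r.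
Qed.

Lemma avg_sum (R : realType) (V I : finType) (mu : V -> R) (T : Type)
    (r : seq T) (P : pred T) (phi : T -> {ffun I -> V} -> R) :
  avg mu (fun f => \sum_(k <- r | P k) phi k f) =
  \sum_(k <- r | P k) avg mu (phi k).
Proof.
rewrite exchange_big /=; apply: eq_bigr => f _.
by rewrite mulr_sumr.
Qed.

Lemma avg_cst (R : realType) (V I : finType) (mu : V -> R) (c : R) :
  \sum_w mu w = 1 -> avg mu (fun _ : {ffun I -> V} => c) = c.
Proof.
move=> mu1; rewrite /avg -mulr_suml.
rewrite -(bigA_distr_bigA (fun (_ : I) w => mu w)) /=.
by rewrite big1 ?mul1r// => i _.
Qed.

(** Replacing one coordinate by a fresh independent sample does not change
    an expectation: exchanging the old and the fresh value is an involution
    that preserves the weights. *)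
Lemma avg_resample (R : realType) (V I : finType) (mu : V -> R) (i : I)
    (phi : {ffun I -> V} -> R) :
  \sum_w mu w = 1 ->
  avg mu phi = avg mu (fun f => \sum_w mu w * phi (upd f i w)).
Proof.
move=> mu1; rewrite /avg.
under [RHS]eq_bigr do rewrite mulr_sumr.
rewrite pair_bigA /=.
(* The pair consists of all old coordinates and the fresh value of the
   [i]-th one. *)
pose swap (p : {ffun I -> V} * V) := (upd p.1 i p.2, p.1 i).
have swapK : involutive swap.
  move=> [f w]; rewrite /swap /= upd_same; congr pair.
  by apply/ffunP => k; rewrite !ffunE; case: eqP => // ->.
rewrite (reindex_inj (inv_inj swapK)) /=.
transitivity (\sum_(p : {ffun I -> V} * V)
    (\prod_k mu (p.1 k)) * phi p.1 * mu p.2); last first.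
  apply: eq_bigr => -[f w] _ /=.
  have -> : upd (upd f i w) i (f i) = f.
    by apply/ffunP => k; rewrite !ffunE; case: eqP => // ->.
  rewrite (bigD1 i) //= [in RHS](bigD1 i) //= upd_same.
  rewrite [in RHS](eq_bigr (fun k : I => mu ((f : {ffun I -> V}) k))).
    by ring.
  by move=> k ki; rewrite upd_other.
rewrite -(pair_bigA _ (fun (f : {ffun I -> V}) w =>
  (\prod_k mu (f k)) * phi f * mu w)) /=.
by apply: eq_bigr => f _; rewrite -mulr_sumr mu1 mulr1.
Qed.

(** The coordinates selected by an injection are again independent samples.
    It lets unused labels be dropped and labels be renamed. *)
Lemma avg_marginal (R : realType) (V I J : finType) (mu : V -> R) (h : J -> I)
    (phi : {ffun J -> V} -> R) :
  injective h -> \sum_w mu w = 1 ->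
  avg mu (fun f : {ffun I -> V} => phi [ffun j => f (h j)]) = avg mu phi.
Proof.
move=> hinj mu1; rewrite /avg.
rewrite (partition_big (fun f : {ffun I -> V} => [ffun j => f (h j)])
  predT) //=.
apply: eq_bigr => g _.
pose Q (i : I) : pred V := fun w => [forall j, (h j == i) ==> (w == g j)].
have QE (f : {ffun I -> V}) : ([ffun j => f (h j)] == g) = (f \in family Q).
  apply/eqP/familyP => [fg i|fQ].
    by apply/forallP => j; apply/implyP => /eqP <-; rewrite -fg ffunE.
  apply/ffunP => j; rewrite ffunE.
  by have /forallP/(_ j) := fQ (h j); rewrite eqxx => /eqP.
rewrite (eq_bigl _ _ QE).
under eq_bigr => f do rewrite -QE => /eqP ->.
rewrite -mulr_suml -(bigA_distr_big_dep Q (fun _ w => mu w)) /=.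
congr (_ * _).
(* The coordinates outside the image of [h] are unconstrained and
   have total mass 1. *)
rewrite (bigID (mem (codom h))) /= [X in _ * X]big1 ?mulr1; last first.
  move=> i iNh; rewrite -[RHS]mu1; apply: eq_bigl => w.
  apply/forallP => j; apply/implyP => /eqP hj.
  by rewrite -hj codom_f in iNh.
rewrite (eq_bigl [in [set h j | j : J]%SET]); last first.
  move=> i; apply/codomP/imsetP => [[j ->]|[j _ ->]]; by exists j.
rewrite big_imset /=; last by move=> j j' _ _; apply: hinj.
apply: eq_big => [j|j _]; first by rewrite inE.
rewrite (big_pred1 (g j)) // => w.
apply/forallP/eqP => [/(_ j)|-> j']; first by rewrite eqxx => /eqP.
by apply/implyP => /eqP /hinj ->.
Qed.

(** * Homomorphism densities as averages *)

Definition unif (R : realType) (V : finType) : V -> R :=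
  fun _ => #|V|%:R^-1.

(** Homomorphisms into a bare relation: the targets used below are weighted
    disjoint unions and graphs with deleted edges as well as graphs. *)
Definition relhom (F : graph) (V : finType) (e : rel V) (f : {ffun F -> V}) :
    bool :=
  [forall x, forall y, adj x y ==> e (f x) (f y)].

Lemma relhomP (F : graph) (V : finType) (e : rel V) (f : {ffun F -> V}) :
  reflect (forall x y, adj x y -> e (f x) (f y)) (relhom e f).
Proof.
apply: (iffP forallP) => [H x y|H x]; first by move/forallP/(_ y)/implyP: (H x).
by apply/forallP => y; apply/implyP; apply: H.
Qed.

Lemma unif_sum (R : realType) (G : graph) : \sum_(w : G) unif R w = 1.
Proof.
rewrite sumr_const -[_ *+ _]mulr_natr mulVf// pnatr_eq0 -lt0n.
exact: vertex_gt0.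
Qed.

Lemma unif_ge0 (R : realType) (V : finType) (w : V) : 0 <= unif R w.
Proof. by rewrite invr_ge0 ler0n. Qed.

Lemma sum_indic (R : realType) (T : finType) (P : pred T) :
  \sum_x (P x)%:R = #|[set x | P x]%SET|%:R :> R.
Proof.
rewrite cardsE -sum1_card natr_sum [RHS]big_mkcond; apply: eq_bigr => x _.
by rewrite unfold_in; case: (P x).
Qed.

Lemma t_avg (R : realType) (F G : graph) :
  t R F G = avg (@unif R G) (fun f : {ffun F -> G} => (relhom (@adj G) f)%:R).
Proof.
rewrite /t /avg card_ffun.
under [RHS]eq_bigr do rewrite prodr_const mulrC.
by rewrite -mulr_suml sum_indic /unif natrX exprVn.
Qed.

(** Homomorphisms that land in a part [A] isomorphic to [G], whose weight
    [a] is spread evenly, contribute the density of [G] scaled by one factor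
    [a] per vertex of [F]. *)
Lemma avg_hom_part (R : realType) (F G : graph) (V : finType) (mu : V -> R)
    (e : rel V) (A : pred V) (h : G -> V) (a : R) :
  injective h -> codom h =i A ->
  (forall x, mu (h x) = a / (v G)%:R) ->
  (forall x y, e (h x) (h y) = adj x y) ->
  avg mu (fun f : {ffun F -> V} => ([forall i, A (f i)] && relhom e f)%:R) =
  a ^+ v F * t R F G.
Proof.
move=> hinj hA hmu he.
pose H (g : {ffun F -> G}) : {ffun F -> V} := [ffun i => h (g i)].
have Hinj : injective H.
  move=> g g' /ffunP E; apply/ffunP => i.
  by have := E i; rewrite !ffunE => /hinj.
have HE (f : {ffun F -> V}) :
    (f \in [set H g | g : {ffun F -> G}]%SET) = [forall i, A (f i)].
  apply/imsetP/forallP => [[g _ ->] i|Af].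
    by have := codom_f h (g i); rewrite hA /H ffunE.
  have Cf i : f i \in codom h by rewrite hA; apply: Af.
  exists [ffun i => iinv (Cf i)] => //.
  by apply/ffunP => i; rewrite !ffunE f_iinv.
rewrite t_avg /avg (bigID (fun f : {ffun F -> V} => [forall i, A (f i)])) /=.
rewrite [X in _ + X]big1 ?addr0; last by move=> f /negbTE ->; rewrite mulr0.
rewrite -(eq_bigl _ _ HE) big_imset /=; last by move=> g g' _ _; apply: Hinj.
rewrite mulr_sumr; apply: eq_big => [g|g _]; first by rewrite inE.
rewrite -HE imset_f //=.
have -> : relhom e (H g) = relhom (@adj G) g.
  by apply/relhomP/relhomP => K x y /K; rewrite !ffunE he.
rewrite mulrA; congr (_ * _); rewrite (eq_bigr (fun=> a / (v G)%:R)).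
  by rewrite !prodr_const exprMn.
by move=> i _; rewrite ffunE hmu.
Qed.

(** A homomorphic image of a connected graph stays in one of two parts with
    no edges between them; this is where direct sums come from. *)
Lemma avg_hom_dsum (R : realType) (F G1 G2 : graph) (V : finType)
    (mu : V -> R) (e : rel V) (A : pred V) (h1 : G1 -> V) (h2 : G2 -> V)
    (a1 a2 : R) :
  connected_graph F ->
  (forall x y, e x y -> A x = A y) ->
  injective h1 -> codom h1 =i A ->
  (forall x, mu (h1 x) = a1 / (v G1)%:R) ->
  (forall x y, e (h1 x) (h1 y) = adj x y) ->
  injective h2 -> codom h2 =i predC A ->
  (forall x, mu (h2 x) = a2 / (v G2)%:R) ->
  (forall x y, e (h2 x) (h2 y) = adj x y) ->
  avg mu (fun f : {ffun F -> V} => (relhom e f)%:R) =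
  a1 ^+ v F * t R F G1 + a2 ^+ v F * t R F G2.
Proof.
move=> Fconn eA h1i h1A h1m h1e h2i h2A h2m h2e.
rewrite -(avg_hom_part _ h1i h1A h1m h1e) -(avg_hom_part _ h2i h2A h2m h2e).
rewrite -avgD; apply: eq_avg => f.
case: (boolP (relhom e f)) => [/relhomP fhom|_]; last by rewrite !andbF addr0.
have const x y : A (f x) = A (f y).
  have /forallP/(_ x)/forallP/(_ y)/connectP[p pth ->] := Fconn.
  elim: p x pth => [|z p IH] x //= /andP[/fhom/eA -> /IH]; exact.
have /card_gt0P[x0 _] := vertex_gt0 F.
have -> : [forall i, A (f i)] = A (f x0).
  by apply/forallP/idP => [//|Ax0 i]; rewrite (const i x0).
have -> : [forall i, predC A (f i)] = ~~ A (f x0).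
  by apply/forallP/idP => [/(_ x0)//|Ax0 i]; rewrite /= (const i x0).
by case: (A _); rewrite ?addr0 ?add0r.
Qed.

(** * Products of adjacency indicators along connected patterns *)

Definition lrel (I : finType) (s : seq (I * I)) : rel I :=
  fun i j => ((i, j) \in s) || ((j, i) \in s).

Definition monomial (I V : finType) (e : rel V) (f : {ffun I -> V})
    (s : seq (I * I)) : bool :=
  all (fun p => e (f p.1) (f p.2)) s.

(** The edge list [s] has no loops and every edge is connected to [x] inside
    [s]. Both closure under concatenation and connectedness of the resulting
    graph are immediate from this form. *)
Definition rooted (I : finType) (x : I) (s : seq (I * I)) : Prop :=
  forall p, p \in s -> (p.1 != p.2) /\ connect (lrel s) x p.1.

Lemma lrel_sym (I : finType) (s : seq (I * I)) : symmetric (lrel s).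
Proof. by move=> i j; rewrite /lrel orbC. Qed.

Definition labels (I : finType) (s : seq (I * I)) : pred I :=
  fun i => [exists j, lrel s i j].

(** A nonempty rooted edge list is a connected graph once the labels that
    it does not touch are removed; those integrate out to 1. *)
Lemma pattern_graph (I : finType) (x : I) (s : seq (I * I)) :
  rooted x s -> s != [::] ->
  exists2 F : graph, connected_graph F &
  forall (R : realType) (V : finType) (mu : V -> R) (e : rel V),
    symmetric e -> \sum_w mu w = 1 ->
    avg mu (fun f : {ffun I -> V} => (monomial e f s)%:R) =
    avg mu (fun f : {ffun F -> V} => (relhom e f)%:R).
Proof.
move=> sx s0.
have lP i j : lrel s i j -> connect (lrel s) x i.
  move=> /orP[/sx[]//|ijs]; have [_ xj] := sx _ ijs.
  by apply: connect_trans xj (connect1 _); rewrite /lrel ijs.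
have lirr : irreflexive (lrel s).
  by move=> i; apply/negP => /orP[] /sx[]; rewrite eqxx.
pose T := {i : I | labels s i}.
pose eT : rel T := fun i j => lrel s (val i) (val j).
have esym : symmetric eT by move=> i j; apply: lrel_sym.
have eirr : irreflexive eT by move=> i; apply: lirr.
have lab i j : lrel s i j -> labels s i by move=> ij; apply/existsP; exists j.
have cardT : (0 < #|{: T}|)%N.
  case: s s0 @T @eT esym eirr lab {sx lP lirr} => [//|[i j] s'] _ T eT _ _ lab.
  apply/card_gt0P; have ij : lrel ((i, j) :: s') i j by rewrite /lrel mem_head.
  by exists (Sub i (lab _ _ ij)).
exists (Graph esym eirr cardT).
  have econn (i j : T) : connect (lrel s) (val i) (val j) -> connect eT i j.
    move=> /connectP[p]; elim: p i => [|k p IH] i /=.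
      by move=> _ /val_inj ->; apply: connect0.
    move=> /andP[ik kp] jp.
    have kl : labels s k by apply: (@lab k (val i)); rewrite lrel_sym.
    apply: connect_trans (IH (Sub k kl) kp jp).
    exact: connect1.
  apply/forallP => i; apply/forallP => j; apply: econn.
  have xl (k : T) : connect (lrel s) x (val k).
    by case/existsP: (valP k) => l; apply: lP.
  apply: connect_trans (xl j).
  by rewrite (sym_connect_sym (lrel_sym s)) xl.
move=> R V mu e sym mu1; set F := Graph _ _ _.
rewrite -(@avg_marginal R V I F mu (val : T -> I) _ val_inj mu1).
apply: eq_avg => f; congr (_%:R); congr nat_of_bool.
apply/allP/relhomP => [H i j|H [i j] ijs /=].
  rewrite !ffunE => /orP[/H//|/H /=]; by rewrite sym.
have ij : lrel s i j by rewrite /lrel ijs.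
have ji : lrel s j i by rewrite lrel_sym.
by have := H (Sub i (lab _ _ ij)) (Sub j (lab _ _ ji)) ij; rewrite !ffunE.
Qed.

(** Random variables that are, uniformly in the target graph, a fixed linear
    combination of edge products rooted at [x]. The label [b] is required to be
    connected to [x] in each of them, so that an edge at [b] can be appended. *)
Definition spanned (R : realType) (I : finType) (x b : I)
    (phi : forall V : finType, rel V -> {ffun I -> V} -> R) : Prop :=
  exists2 L : seq (R * seq (I * I)),
    (forall p, p \in L ->
      [/\ rooted x p.2, p.2 != [::] & connect (lrel p.2) x b]) &
    forall V e f, phi V e f = \sum_(p <- L) p.1 * (monomial e f p.2)%:R.

Lemma lrel_catl (I : finType) (s s' : seq (I * I)) :
  subrel (connect (lrel s)) (connect (lrel (s ++ s'))).
Proof.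
apply: connect_sub => i j ij; apply: connect1.
by move: ij; rewrite /lrel !mem_cat => /orP[] ->; rewrite ?orbT.
Qed.

Lemma lrel_catr (I : finType) (s s' : seq (I * I)) :
  subrel (connect (lrel s')) (connect (lrel (s ++ s'))).
Proof.
apply: connect_sub => i j ij; apply: connect1.
by move: ij; rewrite /lrel !mem_cat => /orP[] ->; rewrite ?orbT.
Qed.

Lemma rooted_cat (I : finType) (x : I) (s s' : seq (I * I)) :
  rooted x s -> rooted x s' -> rooted x (s ++ s').
Proof.
move=> sx sx' p; rewrite mem_cat => /orP[/sx|/sx'] [-> c]; split=> //.
  exact: lrel_catl.
exact: lrel_catr.
Qed.

Lemma spanned_edge (R : realType) (I : finType) (x b : I) :
  x != b ->
  @spanned R I x b (fun V e f => (e (f x) (f b))%:R).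
Proof.
move=> xb; exists [:: (1, [:: (x, b)])].
  move=> p; rewrite inE => /eqP -> /=; split=> //.
    by move=> q; rewrite inE => /eqP -> /=; rewrite connect0.
  by apply: connect1; rewrite /lrel mem_head.
by move=> V e f; rewrite big_seq1 mul1r /monomial /= andbT.
Qed.

Lemma spannedD (R : realType) (I : finType) (x b : I) phi psi :
  @spanned R I x b phi -> spanned x b psi ->
  spanned x b (fun V e f => phi V e f + psi V e f).
Proof.
move=> [L Lx LE] [L' Lx' LE']; exists (L ++ L').
  by move=> p; rewrite mem_cat => /orP[/Lx|/Lx'].
by move=> V e f; rewrite LE LE' big_cat.
Qed.

Lemma spannedN (R : realType) (I : finType) (x b : I) phi :
  @spanned R I x b phi -> spanned x b (fun V e f => - phi V e f).
Proof.
move=> [L Lx LE]; exists [seq (- p.1, p.2) | p <- L].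
  by move=> p /mapP[q /Lx ? ->].
move=> V e f; rewrite LE big_map -sumrN; apply: eq_bigr => p _ /=.
by rewrite mulNr.
Qed.

(** Concatenating two edge lists rooted at the same vertex gives a rooted
    edge list, so connected patterns are closed under products. *)
Lemma spannedM (R : realType) (I : finType) (x a b : I) phi psi :
  @spanned R I x a phi -> spanned x b psi ->
  spanned x b (fun V e f => phi V e f * psi V e f).
Proof.
move=> [L Lx LE] [L' Lx' LE'].
exists [seq (p.1 * q.1, p.2 ++ q.2) | p <- L, q <- L'].
  move=> _ /allpairsP[[p q] [/Lx[px p0 _] /Lx'[qx q0 qb] ->]] /=; split.
  - exact: rooted_cat.
  - by rewrite -size_eq0 size_cat addn_eq0 negb_and !size_eq0 p0.
  - exact: lrel_catr.
move=> V e f; rewrite LE LE' big_allpairs_dep mulr_suml; apply: eq_bigr => p _.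
rewrite mulr_sumr; apply: eq_bigr => q _ /=.
by rewrite /monomial all_cat -mulnb natrM mulrACA.
Qed.

Lemma spanned_extend (R : realType) (I : finType) (x a b : I) phi :
  a != b -> @spanned R I x a phi ->
  spanned x b (fun V e f => phi V e f * (e (f a) (f b))%:R).
Proof.
move=> ab [L Lx LE]; exists [seq (p.1, (a, b) :: p.2) | p <- L].
  move=> _ /mapP[p /Lx[px p0 pa] ->] /=.
  have xa : connect (lrel ((a, b) :: p.2)) x a.
    exact: (@lrel_catr _ [:: (a, b)]).
  split=> //.
    move=> q; rewrite inE => /orP[/eqP -> //|/px[-> xq]]; split=> //.
    exact: (@lrel_catr _ [:: (a, b)]).
  by apply: connect_trans xa (connect1 _); rewrite /lrel mem_head.
move=> V e f; rewrite LE big_map mulr_suml; apply: eq_bigr => p _ /=.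
by rewrite -mulrA -natrM mulnb andbC.
Qed.

Lemma spanned_ext (R : realType) (I : finType) (x b : I) phi psi :
  (forall V e f, phi V e f = psi V e f) ->
  @spanned R I x b psi -> spanned x b phi.
Proof. by move=> E [L Lx LE]; exists L => // V e f; rewrite E. Qed.

(** * Random exploration of a graph *)

(** The set of vertices found after [j] steps: a sample that has already been
    found contributes all its neighbours, any other sample is discarded. Hence
    [reach e z j] depends on [z 0, ..., z j] only. *)
Fixpoint reach (V : finType) (e : rel V) (z : nat -> V) (j : nat) : pred V :=
  if j is j'.+1 then
    fun w => reach e z j' w || reach e z j' (z j) && e (z j) w
  else e (z 0).

Definition samples (V : finType) (N : nat) (f : {ffun 'I_N.+1 -> V}) :
    nat -> V := fun i => f (inord i).

Lemma inord_neq (N i k : nat) :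
  (i <= N)%N -> (k <= N)%N -> i != k -> (inord i : 'I_N.+1) != inord k.
Proof.
by move=> iN kN; apply: contra_neq => /(congr1 val); rewrite /= !inordK.
Qed.

(** Being reached satisfies [r' = r + p - r * p], where [p] says that the
    new sample is reached and adjacent to the vertex; all three terms are
    connected patterns because each factor is rooted at the starting vertex. *)
Lemma reach_spanned (R : realType) (N j k : nat) :
  (j < k)%N -> (k <= N)%N ->
  @spanned R 'I_N.+1 (inord 0) (inord k)
    (fun V e f => (reach e (samples f) j (samples f k))%:R).
Proof.
elim: j k => [|j IH] k jk kN.
  by apply: spanned_edge; apply: inord_neq; rewrite // ltn_eqF.
have jN : (j.+1 <= N)%N by apply: leq_trans kN; apply: ltnW.
pose r V e f : R := (@reach V e (samples (N:=N) f) j (samples f k))%:R.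
pose r' V e f : R := (@reach V e (samples (N:=N) f) j (samples f j.+1))%:R.
have sr : spanned (inord 0) (inord k) r by apply: IH => //; apply: ltnW.
have sr' : spanned (inord 0) (inord k) (fun V e f =>
    r' V e f * (e (f (inord j.+1)) (f (inord k)))%:R).
  by apply: spanned_extend; [rewrite inord_neq // ltn_eqF|apply: IH].
apply: spanned_ext (spannedD (spannedD sr sr') (spannedN (spannedM sr sr'))).
move=> V e f /=; rewrite /r /r' /samples.
by case: (reach _ _ _ (f (inord k))); case: (reach _ _ _ _); case: (e _ _);
  rewrite /= ?mulr0 ?mul0r ?mulr1; ring.
Qed.

(** The labels [1, ..., N] drive the exploration from label [0]; label [N.+1]
    is the vertex that should remain unreached, and label [N.+2], as a
    neighbour of the start, makes starts of high degree more likely. *)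
Definition missed (V : finType) (e : rel V) (N : nat)
    (f : {ffun 'I_N.+3 -> V}) : bool :=
  e (samples f 0) (samples f N.+2) && ~~ reach e (samples f) N (samples f N.+1).

Lemma missed_spanned (R : realType) (N : nat) :
  @spanned R 'I_N.+3 (inord 0) (inord N.+2) (fun V e f => (missed e f)%:R).
Proof.
have s1 : @spanned R 'I_N.+3 (inord 0) (inord N.+2) (fun V e f =>
    (e (samples f 0) (samples f N.+2))%:R).
  by apply: spanned_edge; apply: inord_neq.
have s2 := @reach_spanned R N.+2 N N.+1 (ltnSn _) (leqnSn _).
apply: spanned_ext (spannedD s1 (spannedN (spannedM s2 s1))).
move=> V e f /=; rewrite /missed.
by case: (reach _ _ _ _); case: (e _ _);
  rewrite /= ?mulr0 ?mul0r ?mulr1 ?subrr ?subr0 ?oppr0 ?addr0.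
Qed.

Lemma reach_side (V : finType) (e : rel V) (A : pred V) (z : nat -> V) j w :
  (forall a b, e a b -> A a = A b) -> reach e z j w -> A w = A (z 0).
Proof.
move=> eA; elim: j w => [|j IH] w /=; first by move/eA.
by case/orP => [/IH//|/andP[/IH <- /eA]].
Qed.

Lemma reach0 (V : finType) (e : rel V) (z : nat -> V) j w :
  e (z 0) w -> reach e z j w.
Proof. by elim: j => //= j IH /IH ->. Qed.

Lemma reach_mono (V : finType) (e : rel V) (z : nat -> V) j k w :
  (j <= k)%N -> reach e z j w -> reach e z k w.
Proof.
elim: k => [|k IH]; first by rewrite leqn0 => /eqP ->.
by rewrite leq_eqVlt => /orP[/eqP -> //|/IH{}IH /IH /= ->].
Qed.

Lemma eq_reach (V : finType) (e : rel V) (z z' : nat -> V) j :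
  (forall i, (i <= j)%N -> z i = z' i) -> reach e z j =1 reach e z' j.
Proof.
elim: j => [|j IH] zz w /=; first by rewrite zz.
have E : reach e z j =1 reach e z' j by apply: IH => i ij; apply/zz/ltnW.
by rewrite !E zz.
Qed.

Lemma samples_upd (V : finType) (N : nat) (f : {ffun 'I_N.+1 -> V}) k w i :
  (i <= N)%N -> (k <= N)%N ->
  samples (upd f (inord k) w) i = if i == k then w else samples f i.
Proof.
move=> iN kN; case: eqP => [->|/eqP ik]; first by rewrite /samples upd_same.
by rewrite /samples upd_other // inord_neq.
Qed.

Lemma reach_upd (V : finType) (e : rel V) (N : nat) (f : {ffun 'I_N.+1 -> V})
    j k w :
  (j < k)%N -> (k <= N)%N ->
  reach e (samples (upd f (inord k) w)) j =1 reach e (samples f) j.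
Proof.
move=> jk kN; apply: eq_reach => i ij.
have ik : (i < k)%N by apply: leq_ltn_trans jk.
rewrite samples_upd ?ltn_eqF //.
exact: leq_trans (ltnW ik) kN.
Qed.

Lemma avg_edge (R : realType) (V I : finType) (mu : V -> R) (e : rel V)
    (i j : I) :
  \sum_w mu w = 1 -> i != j ->
  avg mu (fun f : {ffun I -> V} => (e (f i) (f j))%:R) =
  \sum_a mu a * \sum_b mu b * (e a b)%:R.
Proof.
move=> mu1 ij; rewrite (avg_resample j) //.
rewrite (eq_avg _ (psi := fun f => \sum_b mu b * (e (f i) b)%:R)); last first.
  by move=> f; apply: eq_bigr => b _; rewrite upd_same upd_other.
rewrite (avg_resample i) //.
rewrite (eq_avg _ (psi := fun f => \sum_a mu a * \sum_b mu b * (e a b)%:R)).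
  by rewrite avg_cst.
by move=> f; apply: eq_bigr => a _; rewrite upd_same.
Qed.

(** When [e] respects the bipartition [A], the exploration never crosses it,
    so a sample on the other side of the starting vertex is missed whatever
    [N] is. That sample is independent of the edge at the start. *)
Lemma missed_lower (R : realType) (V : finType) (mu : V -> R) (e : rel V)
    (A : pred V) (beta : R) (N : nat) :
  (forall w, 0 <= mu w) -> \sum_w mu w = 1 ->
  (forall a b, e a b -> A a = A b) ->
  beta <= \sum_w mu w * (A w)%:R ->
  beta <= \sum_w mu w * (~~ A w)%:R ->
  beta * (\sum_a mu a * \sum_b mu b * (e a b)%:R) <=
  avg mu (fun f : {ffun 'I_N.+3 -> V} => (missed e f)%:R).
Proof.
move=> mu0 mu1 eA bA bNA.
rewrite -(@avg_edge R V _ mu e (inord 0 : 'I_N.+3) (inord N.+2)) //; last first.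
  exact: inord_neq.
rewrite -avgZ.
pose psi (f : {ffun 'I_N.+3 -> V}) : R :=
  (e (samples f 0) (samples f N.+2))%:R *
  (A (samples f N.+1) != A (samples f 0))%:R.
apply: (@le_trans _ _ (avg mu psi)); last first.
  apply: le_avg => // f; rewrite /psi /missed -natrM mulnb ler_nat.
  case: (e _ _) => //=.
  case: (boolP (reach _ _ _ _)) => [/(reach_side eA) ->|_].
    by rewrite eqxx.
  by rewrite leq_b1.
rewrite (avg_resample (inord N.+1) psi) //; apply: le_avg => // f.
rewrite (eq_bigr (fun w => (e (samples f 0) (samples f N.+2))%:R *
    (mu w * (A w != A (samples f 0))%:R))); last first.
  move=> w _; rewrite /psi !samples_upd //= eqxx.
  by rewrite (gtn_eqF (ltnSn _)) mulrCA.
rewrite -mulr_sumr mulrC ler_wpM2l //.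
case: (A (samples f 0)).
  apply: le_trans bNA _; apply: ler_sum => w _.
  by rewrite ler_wpM2l // ler_nat; case: (A w).
apply: le_trans bA _; apply: ler_sum => w _.
by rewrite ler_wpM2l // ler_nat; case: (A w).
Qed.

(** * From a missed vertex to a sparse cut *)

Definition vdens (R : realType) (G : graph) (A : pred G) : R :=
  \sum_w unif R w * (A w)%:R.

Definition cutdens (R : realType) (G : graph) (A : pred G) : R :=
  \sum_a unif R a * \sum_b unif R b * (A a && ~~ A b && adj a b)%:R.

Lemma vdens_le1 (R : realType) (G : graph) (A : pred G) : vdens R A <= 1.
Proof.
rewrite -(unif_sum R G); apply: ler_sum => w _.
by rewrite ler_piMr ?unif_ge0 // lern1 leq_b1.
Qed.

Lemma vdens_ge0 (R : realType) (G : graph) (A : pred G) : 0 <= vdens R A.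
Proof. by apply: sumr_ge0 => w _; rewrite mulr_ge0 ?unif_ge0. Qed.

Lemma cutdens_ge0 (R : realType) (G : graph) (A : pred G) : 0 <= cutdens R A.
Proof.
apply: sumr_ge0 => a _; rewrite mulr_ge0 ?unif_ge0 //.
by apply: sumr_ge0 => b _; rewrite mulr_ge0 ?unif_ge0.
Qed.

(** The exploration uses neither of the two test vertices, so each of them
    can be averaged out separately. *)
Lemma avg_missed (R : realType) (G : graph) (N : nat) :
  avg (@unif R G) (fun f : {ffun 'I_N.+3 -> G} => (missed (@adj G) f)%:R) =
  avg (@unif R G) (fun f : {ffun 'I_N.+3 -> G} =>
    vdens R (@adj G (samples f 0)) *
    vdens R (predC (reach (@adj G) (samples f) N))).
Proof.
have mu1 := unif_sum R G.
rewrite (avg_resample (inord N.+2)) //.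
rewrite (eq_avg _ (psi := fun f : {ffun 'I_N.+3 -> G} =>
    vdens R (@adj G (samples f 0)) *
    (~~ reach (@adj G) (samples f) N (samples f N.+1))%:R)); last first.
  move=> f; rewrite /vdens mulr_suml; apply: eq_bigr => w _.
  rewrite /missed reach_upd // !samples_upd //= eqxx (ltn_eqF (ltnSn _)).
  by rewrite -mulrA -natrM mulnb.
rewrite (avg_resample (inord N.+1)) //; apply: eq_avg => f.
rewrite [X in _ = _ * X]/vdens mulr_sumr; apply: eq_bigr => w _.
by rewrite reach_upd // !samples_upd //= eqxx mulrCA.
Qed.

(** The new sample is independent of the set explored so far, and a vertex
    is gained exactly when it is unexplored and adjacent to the new sample,
    itself explored. So the expected gain is the cut density. *)
Lemma avg_reach_step (R : realType) (G : graph) (N j : nat) :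
  (j < N)%N ->
  avg (@unif R G) (fun f : {ffun 'I_N.+1 -> G} =>
    vdens R (reach (@adj G) (samples f) j.+1)) -
  avg (@unif R G) (fun f : {ffun 'I_N.+1 -> G} =>
    vdens R (reach (@adj G) (samples f) j)) =
  avg (@unif R G) (fun f : {ffun 'I_N.+1 -> G} =>
    cutdens R (reach (@adj G) (samples f) j)).
Proof.
move=> jN; have mu1 := unif_sum R G.
rewrite -avgB (avg_resample (inord j.+1)) //; apply: eq_avg => f.
apply: eq_bigr => a _; congr (_ * _).
rewrite /vdens -sumrB; apply: eq_bigr => b _.
rewrite -mulrBr; congr (_ * _); rewrite /= !reach_upd //.
rewrite samples_upd // eqxx.
by case: (reach _ _ _ b); case: (reach _ _ _ a); case: (adj a b);
  rewrite /= ?subrr ?subr0.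
Qed.

(** The gains telescope, and a vertex density never exceeds 1. *)
Lemma sum_cutdens_reach (R : realType) (G : graph) (N : nat) :
  \sum_(j < N) avg (@unif R G) (fun f : {ffun 'I_N.+3 -> G} =>
    cutdens R (reach (@adj G) (samples f) j)) <= 1.
Proof.
rewrite (eq_bigr (fun j : 'I_N =>
  avg (@unif R G) (fun f : {ffun 'I_N.+3 -> G} =>
    vdens R (reach (@adj G) (samples f) j.+1)) -
  avg (@unif R G) (fun f : {ffun 'I_N.+3 -> G} =>
    vdens R (reach (@adj G) (samples f) j)))); last first.
  move=> j _; rewrite avg_reach_step //.
  by apply: leq_trans (ltn_ord j) _; do 2!apply: leqW.
rewrite -(big_mkord predT (fun j => avg _ (fun f : {ffun 'I_N.+3 -> G} =>
    vdens R (reach (@adj G) (samples f) j.+1)) -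
  avg _ (fun f : {ffun 'I_N.+3 -> G} =>
    vdens R (reach (@adj G) (samples f) j)))) telescope_sumr //.
apply: le_trans (_ : avg (@unif R G) (fun f : {ffun 'I_N.+3 -> G} =>
    vdens R (reach (@adj G) (samples f) N)) <= _).
  rewrite gerBl; apply: sumr_ge0 => f _.
  by rewrite mulr_ge0 ?vdens_ge0 // prodr_ge0 // => i _; rewrite unif_ge0.
rewrite -[leRHS](@avg_cst R G 'I_N.+3 _ 1 (unif_sum R G)).
by apply: le_avg => [w|f]; rewrite ?unif_ge0 ?vdens_le1.
Qed.

(** The probability of [missed] bounds, for every [j], the expected product
    of the degree of the start and the density of the unexplored set, while
    the expected cut densities sum to at most 1. Weighting the latter by
    [c * N / 4] keeps the difference above [c / 2] for some outcome, which
    then bounds all three quantities simultaneously. *)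
Lemma exists_cut (R : realType) (G : graph) (N : nat) (c : R) :
  0 < c -> (0 < N)%N ->
  c <= avg (@unif R G)
         (fun f : {ffun 'I_N.+3 -> G} => (missed (@adj G) f)%:R) ->
  exists A : pred G,
    [/\ c / 2 <= vdens R A, c / 2 <= vdens R (predC A) &
        cutdens R A <= 4 / (c * N%:R)].
Proof.
move=> c0 N0 cm; have N0' : 0 < N%:R :> R by rewrite ltr0n.
pose X (j : nat) (f : {ffun 'I_N.+3 -> G}) : R :=
  vdens R (@adj G (samples f 0)) *
  vdens R (predC (reach (@adj G) (samples f) j))
  - c * N%:R / 4 * cutdens R (reach (@adj G) (samples f) j).
have [[j [f jf]]|/forallNP noX] :=
    pselect (exists j f, (j < N)%N /\ c / 2 <= X j f); last first.
  exfalso.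
  have up : \sum_(j < N) avg (@unif R G) (X j) <= \sum_(j < N) (c / 2).
    apply: ler_sum => j _.
    rewrite -[leRHS](@avg_cst R G 'I_N.+3 _ _ (unif_sum R G)).
    apply: le_avg => [w|f]; first exact: unif_ge0.
    rewrite leNgt; apply/negP => cX; apply: (noX j); exists f; split => //.
    exact: ltW.
  have low : \sum_(j < N) (c : R) - c * N%:R / 4 <=
      \sum_(j < N) avg (@unif R G) (X j).
    rewrite /X; under [leRHS]eq_bigr do rewrite avgB avgZ.
    rewrite sumrB -mulr_sumr; apply: lerB.
      apply: ler_sum => j _; apply: le_trans cm _; rewrite avg_missed.
      apply: le_avg => [w|f]; first exact: unif_ge0.
      rewrite ler_wpM2l ?vdens_ge0 //; apply: ler_sum => w _.
      rewrite ler_wpM2l ?unif_ge0 // ler_nat /=.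
      have := @reach_mono G (@adj G) (samples f) j N w (ltnW (ltn_ord j)).
      by case: (reach _ _ j w); case: (reach _ _ N w) => // ->.
    by rewrite ler_piMr ?sum_cutdens_reach // divr_ge0 // mulr_ge0 // ltW.
  have := le_trans low up.
  rewrite !sumr_const !card_ord -(mulr_natr c) -(mulr_natr (c / 2)).
  by have := mulr_gt0 c0 N0'; lra.
case: jf => jN cX.
exists (reach (@adj G) (samples f) j).
have cut0 := cutdens_ge0 R (reach (@adj G) (samples f) j).
have d0 := vdens_ge0 R (@adj G (samples f 0)).
have d1 := vdens_le1 R (@adj G (samples f 0)).
have r0 := vdens_ge0 R (predC (reach (@adj G) (samples f) j)).
have r1 := vdens_le1 R (predC (reach (@adj G) (samples f) j)).
have dr : vdens R (@adj G (samples f 0)) <=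
    vdens R (reach (@adj G) (samples f) j).
  apply: ler_sum => w _; rewrite ler_wpM2l ?unif_ge0 // ler_nat.
  by have := @reach0 G (@adj G) (samples f) j w; case: (adj _ w) => // ->.
have cN0 : 0 < c * N%:R by rewrite mulr_gt0.
have cNcut : 0 <= c * N%:R * cutdens R (reach (@adj G) (samples f) j).
  by rewrite mulr_ge0 // ltW.
move: cX; rewrite /X; set rA := reach _ _ _ in cut0 r0 r1 dr cNcut *.
set d := vdens R _ in d0 d1 dr *; set rc := vdens R _ in r0 r1 *.
move=> cX.
have rcd : d * rc <= rc by rewrite ler_piMl.
have drc : d * rc <= d by rewrite ler_piMr.
split; [lra|lra|].
by rewrite ler_pdivlMr // mulrC; lra.
Qed.

(** * Partitions and cut densities *)

Lemma partition_setC (G : graph) (V' V'' : {set G}) :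
  is_partition V' V'' -> V'' = (~: V')%SET.
Proof.
move=> /andP[/eqP VU Vdis]; apply/setP => b; rewrite finset.in_setC.
have := finset.in_setT b; rewrite -VU inE => /orP[bV|bV].
  by rewrite bV (disjointFr Vdis bV).
by rewrite bV (disjointFl Vdis bV).
Qed.

(** For disjoint parts an unordered crossing pair has a unique orientation
    starting in [V'], so counting edges and counting ordered pairs agree. *)
Lemma edges_cutdens (R : realType) (G : graph) (V' V'' : {set G}) :
  is_partition V' V'' ->
  (edges_between V' V'')%:R = cutdens R (mem V') * (v G)%:R ^+ 2.
Proof.
move=> VV.
have V''E b : (b \in V'') = (b \notin V').
  by rewrite (partition_setC VV) finset.in_setC.
pose P (p : G * G) := [&& p.1 \in V', p.2 \notin V' & adj p.1 p.2].
have -> : edges_between V' V'' = #|[set p | P p]%SET|.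
  rewrite /edges_between.
  rewrite -(@card_in_imset _ _ (fun p : G * G => [set p.1; p.2]%SET)).
    apply: eq_card => S; apply/imset2P/imsetP.
      move=> [i j iV]; rewrite inE => /andP[jV ij] ->; exists (i, j) => //.
      by rewrite inE /P /= iV -V''E jV.
    move=> [[i j]]; rewrite inE => /and3P[/= iV jV ij ->].
    by exists i j; rewrite // inE V''E jV.
  move=> [i j] [k l]; rewrite !inE => /and3P[/= iV jV _] /and3P[/= kV lV _] E.
  have : i \in [set k; l]%SET by rewrite -E !inE eqxx.
  have : j \in [set k; l]%SET by rewrite -E !inE eqxx orbT.
  rewrite !inE => /orP[/eqP jk|/eqP ->]; first by rewrite jk kV in jV.
  by move=> /orP[/eqP ->|/eqP il] //; rewrite -il iV in lV.
rewrite -sum_indic -(pair_bigA _ (fun a b => (P (a, b))%:R)) /=.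
rewrite /cutdens mulr_suml.
have n0 : (v G)%:R != 0 :> R by rewrite pnatr_eq0 -lt0n; apply: vertex_gt0.
apply: eq_bigr => a _; rewrite !mulr_sumr mulr_suml; apply: eq_bigr => b _.
rewrite /P /unif /= andbA; move: n0; rewrite /v => n0.
by field.
Qed.

Lemma setC_partition (G : graph) (A : {set G}) : is_partition A (~: A)%SET.
Proof.
rewrite /is_partition finset.setUCr eqxx /=.
by rewrite finset.disjoints_subset finset.setCK.
Qed.

Lemma vdens_card (R : realType) (G : graph) (A : {set G}) :
  #|A|%:R = vdens R (mem A) * (v G)%:R.
Proof.
rewrite /vdens -mulr_sumr sum_indic mulrAC mulVf ?mul1r ?cardsE //.
by rewrite pnatr_eq0 -lt0n vertex_gt0.
Qed.

Definition edgedens (R : realType) (V : finType) (mu : V -> R) (e : rel V) :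
    R :=
  \sum_a mu a * \sum_b mu b * (e a b)%:R.

Lemma cutdens_le_edgedens (R : realType) (G : graph) (A : pred G) :
  cutdens R A <= edgedens (@unif R G) (@adj G).
Proof.
apply: ler_sum => a _; rewrite ler_wpM2l ?unif_ge0 //; apply: ler_sum => b _.
rewrite ler_wpM2l ?unif_ge0 // ler_nat.
by case: (adj _ _); rewrite ?andbF ?leq_b1.
Qed.

Lemma half_cut (R : realType) (G : graph) :
  (2 <= v G)%N ->
  exists A : {set G}, (1 / 4 : R) <= vdens R (mem A) /\
    (1 / 4 : R) <= vdens R (mem (~: A)%SET).
Proof.
move=> n2.
have hn : ((v G)./2 <= #|G|)%N by rewrite -/(v G) -divn2 leq_div.
pose A := [set enum_val (widen_ord hn i) | i : 'I_(v G)./2]%SET.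
have cA : #|A| = (v G)./2.
  rewrite card_imset ?card_ord // => i j /enum_val_inj /(congr1 val) /= ij.
  exact: val_inj.
have cCA : #|(~: A)%SET| = (v G - (v G)./2)%N.
  by rewrite cardsCs finset.setCK cA.
have n0 : 0 < (v G)%:R :> R by rewrite ltr0n vertex_gt0.
exists A; split; rewrite -(ler_pM2r n0) -vdens_card ?cA ?cCA.
  rewrite mulrAC mul1r ler_pdivrMr // -natrM ler_nat.
  by have := odd_double_half (v G); lia.
rewrite mulrAC mul1r ler_pdivrMr // -natrM ler_nat.
by have := odd_double_half (v G); lia.
Qed.

(** * Disconnected limits have sparse balanced cuts *)

(** The limit [m] is determined by the densities of connected graphs, so
    two sequences with the same such limits assign the same limiting
    expectation to [phi], even if the first consists of graphs and the second
    of weighted relations. *)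
Lemma spanned_limit (R : realType) (I : finType) (x b : I) phi (l : graph -> R) :
  @spanned R I x b phi ->
  exists m : R, forall (V : nat -> finType) (mu : forall n, V n -> R)
      (e : forall n, rel (V n)),
    (forall n, symmetric (e n)) -> (forall n, \sum_w mu n w = 1) ->
    (forall F, connected_graph F ->
      avg (mu n) (fun f : {ffun F -> V n} => (relhom (e n) f)%:R)
        @[n --> \oo] --> l F) ->
    avg (mu n) (phi (V n) (e n)) @[n --> \oo] --> m.
Proof.
move=> [L Lx LE].
have {Lx} : exists m : R, forall (V : nat -> finType)
    (mu : forall n, V n -> R) (e : forall n, rel (V n)),
    (forall n, symmetric (e n)) -> (forall n, \sum_w mu n w = 1) ->
    (forall F, connected_graph F ->
      avg (mu n) (fun f : {ffun F -> V n} => (relhom (e n) f)%:R)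
        @[n --> \oo] --> l F) ->
    \sum_(p <- L) p.1 * avg (mu n) (fun f : {ffun I -> V n} =>
       (monomial (e n) f p.2)%:R) @[n --> \oo] --> m.
  elim: L Lx {LE} => [|p L IH] Lx.
    exists 0 => V mu e _ _ _; under eq_cvg do rewrite big_nil.
    exact: cvg_cst.
  have [|m Hm] := IH; first by move=> q qL; apply: Lx; rewrite inE qL orbT.
  have [px p0 _] := Lx p (mem_head _ _).
  have [F Fc FE] := pattern_graph px p0.
  exists (p.1 * l F + m) => V mu e esym mu1 cv.
  under eq_cvg do rewrite big_cons FE //.
  by apply: cvgD; [apply: cvgMl_tmp; apply: cv|apply: Hm].
move=> [m Hm]; exists m => V mu e esym mu1 cv.
apply: cvg_trans (Hm V mu e esym mu1 cv); apply: near_eq_cvg; near=> n.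
rewrite (eq_avg _ (LE (V n) (e n))) avg_sum; apply: eq_bigr => p _.
by rewrite avgZ.
Unshelve. all: by end_near.
Qed.

(** The first summand receives total mass [alpha] and the second [1 - alpha],
    whatever the sizes of the two graphs: a weighted rather than an actual
    disjoint union avoids any adjustment of the sizes. *)
Definition dsum_mu (R : realType) (alpha : R) (G1 G2 : graph)
    (w : G1 + G2) : R :=
  match w with
  | inl _ => alpha / (v G1)%:R
  | inr _ => (1 - alpha) / (v G2)%:R
  end.

Definition dsum_adj (G1 G2 : graph) : rel (G1 + G2) :=
  fun x y => match x, y with
  | inl a, inl b => adj a b
  | inr a, inr b => adj a b
  | _, _ => false
  end.

Definition is_left (A B : Type) (w : A + B) : bool :=
  if w is inl _ then true else false.

Lemma dsum_adj_sym (G1 G2 : graph) : symmetric (@dsum_adj G1 G2).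
Proof. by move=> [a|a] [b|b] //=; apply: adj_sym. Qed.

Lemma dsum_adj_left (G1 G2 : graph) (x y : G1 + G2) :
  dsum_adj x y -> is_left x = is_left y.
Proof. by case: x y => [a|a] [b|b]. Qed.

Lemma dsum_left (R : realType) (alpha : R) (G1 G2 : graph) :
  \sum_(w : G1 + G2) dsum_mu alpha w * (is_left w)%:R = alpha.
Proof.
rewrite big_sumType /= [X in _ + X]big1 ?addr0 => [|w _]; last by rewrite mulr0.
under eq_bigr do rewrite mulr1.
rewrite sumr_const -[_ *+ _]mulr_natr mulfVK // pnatr_eq0 -lt0n.
exact: vertex_gt0.
Qed.

Lemma dsum_right (R : realType) (alpha : R) (G1 G2 : graph) :
  \sum_(w : G1 + G2) dsum_mu alpha w * (~~ is_left w)%:R = 1 - alpha.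
Proof.
rewrite big_sumType /= [X in X + _]big1 ?add0r => [|w _]; last by rewrite mulr0.
under eq_bigr do rewrite mulr1.
rewrite sumr_const -[_ *+ _]mulr_natr mulfVK // pnatr_eq0 -lt0n.
exact: vertex_gt0.
Qed.

Lemma dsum_mu_sum (R : realType) (alpha : R) (G1 G2 : graph) :
  \sum_(w : G1 + G2) dsum_mu alpha w = 1.
Proof.
rewrite -[RHS](subrK alpha) -[X in X + _](dsum_right alpha G1 G2).
rewrite -[X in _ + X](dsum_left alpha G1 G2) -big_split /=.
by apply: eq_bigr => w _; case: is_left; rewrite ?mulr1 ?mulr0 ?addr0 ?add0r.
Qed.

Lemma dsum_mu_ge0 (R : realType) (alpha : R) (G1 G2 : graph) (w : G1 + G2) :
  0 <= alpha <= 1 -> 0 <= dsum_mu alpha w.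
Proof. by move=> /andP[a0 a1]; case: w => w; rewrite divr_ge0 ?subr_ge0. Qed.

Lemma dsum_hom (R : realType) (alpha : R) (F G1 G2 : graph) :
  connected_graph F ->
  avg (@dsum_mu R alpha G1 G2)
    (fun f : {ffun F -> (G1 + G2)%type} => (relhom (@dsum_adj G1 G2) f)%:R) =
  alpha ^+ v F * t R F G1 + (1 - alpha) ^+ v F * t R F G2.
Proof.
move=> Fc; apply: (@avg_hom_dsum _ F G1 G2 _ _ _ (@is_left G1 G2) inl inr) => //.
- exact: dsum_adj_left.
- by move=> a b [].
- move=> [a|a]; rewrite ?codom_f // !unfold_in /=.
  by apply/negP => /codomP[].
- by move=> a b [].
- move=> [a|a]; rewrite ?codom_f // !unfold_in /=.
  by apply/negP => /codomP[].
Qed.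

Lemma near_v_ge (G : nat -> graph) (k : nat) :
  v (G n) @[n --> \oo] --> \oo -> \forall n \near \oo, (k <= v (G n))%N.
Proof. by move=> /cvgnyPge; apply. Qed.

Lemma vdens_set (R : realType) (G : graph) (A : pred G) :
  vdens R (mem [set x | A x]%SET) = vdens R A.
Proof. by apply: eq_bigr => w _; rewrite /= inE. Qed.

Lemma vdens_setC (R : realType) (G : graph) (A : pred G) :
  vdens R (mem (~: [set x | A x])%SET) = vdens R (predC A).
Proof. by apply: eq_bigr => w _; rewrite /= !inE. Qed.

Lemma cutdens_set (R : realType) (G : graph) (A : pred G) :
  cutdens R (mem [set x | A x]%SET) = cutdens R A.
Proof.
apply: eq_bigr => a _; congr (_ * _); apply: eq_bigr => b _.
by rewrite /= !inE.
Qed.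

(** The same expectations of [missed] are computed in [G n] and in the
    weighted disjoint unions; the latter supply the lower bound and the former
    the cut. The case of edge density 0 has to be separated because
    the exploration may then find a negligible set only. *)
Lemma disconnected_cuts (R : realType) (G : nat -> graph)
    (Gamma : graph_limit R) :
  converges_to G Gamma -> disconnected_limit Gamma ->
  exists2 c : R, 0 < c & forall eps : R, 0 < eps ->
    \forall n \near \oo, exists A : {set G n},
      [/\ c <= vdens R (mem A), c <= vdens R (mem (~: A)%SET) &
          cutdens R (mem A) <= eps].
Proof.
move=> [vG tG] [Gamma1 [Gamma2 [alpha [/andP[a0 a1] D]]]].
have [G1 [_ t1]] := tlimP Gamma1; have [G2 [_ t2]] := tlimP Gamma2.
pose V n : finType := (G1 n + G2 n)%type.
pose mu n : V n -> R := @dsum_mu R alpha (G1 n) (G2 n).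
pose e n : rel (V n) := @dsum_adj (G1 n) (G2 n).
have cW F : connected_graph F ->
    avg (mu n) (fun f : {ffun F -> V n} => (relhom (e n) f)%:R)
      @[n --> \oo] --> tlim Gamma F.
  move=> Fc; rewrite D //; under eq_cvg do rewrite dsum_hom //.
  by apply: cvgD; apply: cvgMl_tmp.
have cG F : connected_graph F ->
    avg (@unif R (G n)) (fun f : {ffun F -> G n} => (relhom (@adj (G n)) f)%:R)
      @[n --> \oo] --> tlim Gamma F.
  by move=> _; under eq_cvg do rewrite -t_avg; apply: tG.
have both I x b phi : @spanned R I x b phi -> exists m : R,
    avg (mu n) (phi (V n) (e n)) @[n --> \oo] --> m /\
    avg (@unif R (G n)) (phi _ (@adj (G n))) @[n --> \oo] --> m.
  move=> /(@spanned_limit _ _ _ _ _ (tlim Gamma))[m Hm]; exists m; split.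
    by apply: Hm => // n; [apply: dsum_adj_sym|apply: dsum_mu_sum].
  apply: (Hm (fun n => vertex (G n))) => // n; first exact: adj_sym.
  exact: unif_sum.
have [d [dW dG]] := both _ _ _ _
  (@spanned_edge R 'I_2 ord0 ord_max isT).
have {}dG : edgedens (@unif R (G n)) (@adj (G n)) @[n --> \oo] --> d.
  by move: dG; under eq_cvg do rewrite avg_edge // ?unif_sum //.
have {}dW : edgedens (mu n) (e n) @[n --> \oo] --> d.
  by move: dW; under eq_cvg do rewrite avg_edge // ?dsum_mu_sum //.
have [d0|d0] := leP d 0.
  exists (1 / 4); first by lra.
  move=> eps eps0; near=> n.
  have [|A [A1 A2]] := @half_cut R (G n).
    by near: n; apply: near_v_ge.
  exists A; split => //; apply: le_trans (cutdens_le_edgedens _ _) _.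
  apply: ltW.
  near: n; apply: (cvgr_lt d dG); exact: le_lt_trans eps0.
pose beta := Num.min alpha (1 - alpha).
have beta0 : 0 < beta by rewrite /beta lt_min a0 subr_gt0.
pose c := beta * d / 2; have c0 : 0 < c by rewrite divr_gt0 ?mulr_gt0.
exists (c / 2); first by rewrite divr_gt0.
move=> eps eps0.
(* Large enough for the cut density [4 / (c * N)] of [exists_cut] to be
   at most [eps]. *)
pose N := (Num.truncn (4 / (c * eps))).+1.
have cN : 4 / (c * N%:R) <= eps.
  have /ltW := truncnS_gt (4 / (c * eps)); rewrite -/N.
  rewrite !ler_pdivrMr ?mulr_gt0 ?ltr0n //.
  by rewrite (_ : eps * (c * N%:R) = N%:R * (c * eps)) //; ring.
have [m [mW mG]] := both _ _ _ _ (missed_spanned R N).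
have dm : beta * d <= m.
  have bdW : beta * edgedens (mu n) (e n) @[n --> \oo] --> beta * d.
    exact: cvgMl_tmp.
  apply: (ler_cvg_to bdW mW); near=> n.
  apply: (@missed_lower _ _ _ _ (@is_left (G1 n) (G2 n))).
  - by move=> w; apply: dsum_mu_ge0; rewrite !ltW.
  - exact: dsum_mu_sum.
  - exact: dsum_adj_left.
  - by rewrite dsum_left /beta ge_min lexx.
  - by rewrite dsum_right /beta ge_min lexx orbT.
near=> n.
have [||A [A1 A2 A3]] := @exists_cut R (G n) N c c0.
- by [].
- apply: ltW; near: n; apply: (cvgr_gt m mG); apply: lt_le_trans dm.
  by rewrite /c ltr_pdivrMr // ltr_pMr ?mulr_gt0 // ltr1n.
exists [set x | A x]%SET; rewrite vdens_set vdens_setC cutdens_set; split => //.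
exact: le_trans cN.
Unshelve. all: by end_near.
Qed.

(** * Diagonal subsequences *)

(** A cluster point along an ultrafilter is a limit: the preimage of each
    neighbourhood or its complement belongs to the ultrafilter, and the second
    case contradicts clustering. *)
Lemma ultra_seq_cvg (R : realType) (U : set_system nat) (f : nat -> R) :
  UltraFilter U -> (forall n, 0 <= f n <= 1) -> exists l : R, f @ U --> l.
Proof.
move=> UU f01; have PU : ProperFilter U := ultra_proper.
have : (f @ U) `[0, 1]%classic.
  by apply: (@filterE _ U) => n; rewrite /= in_itv /=; apply: f01.
move=> /(@segment_compact R 0 1)[l [_ lcl]]; exists l => B Bl.
have [//|UB] := in_ultra_setVsetC (f @^-1` B) UU.
by have [r []] := lcl (~` B) B UB Bl.
Qed.

(** All the sequences converge along one ultrafilter finer than the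
    filter of cofinite sets. Finitely many of them can be approximated at the
    same index, so [phi m] is chosen to bring the first [m] of them close to
    their limits. *)
Lemma diagonal_subsequence (R : realType) (C : countType) (u : C -> nat -> R) :
  (forall c n, 0 <= u c n <= 1) ->
  exists (phi : nat -> nat) (l : C -> R),
    (forall m, (m <= phi m)%N) /\
    (forall c, u c (phi m) @[m --> \oo] --> l c).
Proof.
move=> u01.
have [U [UU ooU]] := ultraFilterLemma (eventually_filter : ProperFilter \oo).
have PU : ProperFilter U := ultra_proper.
have [l lU] := choice (fun c => ultra_seq_cvg UU (u01 c)).
have ex m : exists n, (m <= n)%N /\ forall c, (pickle c <= m)%N ->
    `|l c - u c n| < m.+1%:R^-1.
  apply: (@filter_ex _ U).
  apply: filterI; first by apply: ooU; exists m.
  have : \forall n \near U, forall i : 'I_m.+1, forall c, unpickle i = Some c ->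
      `|l c - u c n| < m.+1%:R^-1.
    apply: filter_forall => i; case: (unpickle i) => [c|].
      have : \forall n \near U, `|l c - u c n| < m.+1%:R^-1.
        by move/cvgrPdist_lt: (lU c); apply; rewrite invr_gt0.
      by apply: filterS => n cn c' [<-].
    exact: filterE.
  apply: filterS => n H c cm.
  by apply: (H (Ordinal (cm : (pickle c < m.+1)%N))); rewrite pickleK.
have [phi phiP] := choice ex.
exists phi, l; split=> [m|c]; first by have [] := phiP m.
apply/cvgrPdist_lt => eps eps0; near=> m.
apply: lt_trans ((phiP m).2 c _) _; first by near: m; exists (pickle c).
by near: m; apply: (near_infty_natSinv_lt (PosNum eps0)).
Unshelve. all: by end_near.
Qed.

(** * Countably many densities *)

(** Adjacency tables on initial segments of the integers: a countable type
    indexing all densities [t F], which depend on [F] up to isomorphism. *)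
Definition code : countType := {n : nat & {ffun 'I_n * 'I_n -> bool}}.

Definition code_of (F : graph) : code :=
  Tagged (fun n => {ffun 'I_n * 'I_n -> bool})
    [ffun p : 'I_#|F| * 'I_#|F| => adj (enum_val p.1) (enum_val p.2)].

Definition tcode (R : realType) (c : code) (G : graph) : R :=
  avg (@unif R G) (fun f : {ffun 'I_(tag c) -> G} =>
    [forall i, forall j, (tagged c) (i, j) ==> adj (f i) (f j)]%:R).

Lemma tcodeE (R : realType) (F G : graph) : t R F G = tcode R (code_of F) G.
Proof.
rewrite t_avg /tcode /=.
rewrite -(avg_marginal _ (@enum_val_inj _ F) (unif_sum R G)).
apply: eq_avg => f; congr (_%:R); congr nat_of_bool.
apply/relhomP/forallP => [H i|H x y xy].
  by apply/forallP => j; apply/implyP; rewrite !ffunE => /H.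
have /forallP/(_ (enum_rank y))/implyP := H (enum_rank x).
by rewrite !ffunE !enum_rankK; apply.
Qed.

Lemma avg_01 (R : realType) (G : graph) (I : finType)
    (phi : {ffun I -> G} -> bool) :
  0 <= avg (@unif R G) (fun f => (phi f)%:R) <= 1.
Proof.
rewrite -[X in _ <= _ <= X](@avg_cst R G I _ 1 (unif_sum R G)).
rewrite -[X in X <= _](@avg_cst R G I _ 0 (unif_sum R G)).
by apply/andP; split; apply: le_avg => w; rewrite ?unif_ge0 ?lern1 ?leq_b1.
Qed.

(** * Deleting the edges across a sparse cut *)

Definition induced_vertex (G : graph) (S : {set G}) : finType :=
  {x : G | x \in S}.

Definition induced (G : graph) (S : {set G}) (S0 : (0 < #|S|)%N) : graph.
Proof.
refine (@Graph (induced_vertex S) (fun x y => adj (val x) (val y)) _ _ _).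
- by move=> x y; apply: adj_sym.
- by move=> x; apply: adj_irr.
- by rewrite card_sig.
Defined.

Lemma v_induced (G : graph) (S : {set G}) (S0 : (0 < #|S|)%N) :
  v (induced S0) = #|S|.
Proof. by rewrite /v card_sig. Qed.

Definition sever (G : graph) (S : {set G}) : rel G :=
  fun a b => adj a b && ((a \in S) == (b \in S)).

Lemma vdens_neq0 (R : realType) (G : graph) (S : {set G}) :
  (0 < #|S|)%N -> vdens R (mem S) != 0.
Proof.
apply: contraTneq => d0; rewrite -eqn0Ngt -(eqr_nat R).
by rewrite vdens_card d0 mul0r.
Qed.

Lemma avg_sever (R : realType) (F G : graph) (S : {set G})
    (S1 : (0 < #|S|)%N) (S2 : (0 < #|(~: S)%SET|)%N) :
  connected_graph F ->
  avg (@unif R G) (fun f : {ffun F -> G} => (relhom (sever S) f)%:R) =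
  vdens R (mem S) ^+ v F * t R F (induced S1) +
  (1 - vdens R (mem S)) ^+ v F * t R F (induced S2).
Proof.
have n0 : (v G)%:R != 0 :> R by rewrite pnatr_eq0 -lt0n vertex_gt0.
have dC : 1 - vdens R (mem S) = vdens R (mem (~: S)%SET).
  rewrite -(unif_sum R G) /vdens -sumrB; apply: eq_bigr => w _ /=.
  by rewrite finset.in_setC; case: (w \in S); rewrite ?mulr1 ?mulr0 ?subrr ?subr0.
move=> Fc; apply: (@avg_hom_dsum _ F _ _ _ _ _ (mem S)
  (val : induced S1 -> G) (val : induced S2 -> G)) => //.
- by move=> x y /andP[_ /eqP].
- move=> x; apply/codomP/idP => [[y ->]|xS]; first exact: (valP y).
  by exists (Sub x xS).
- move=> x; rewrite v_induced vdens_card.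
  have d0 := vdens_neq0 R S1.
  by rewrite /unif; field; rewrite n0.
- move=> x y; rewrite /sever.
  have -> : val x \in S by exact: (valP x).
  have -> : val y \in S by exact: (valP y).
  by rewrite andbT.
- move=> x; apply/codomP/idP => [[y ->]|xS].
    by have := valP y; rewrite finset.in_setC.
  have xS' : x \in (~: S)%SET by rewrite finset.in_setC.
  by exists (Sub x xS').
- move=> x; rewrite v_induced vdens_card dC.
  have d0 := vdens_neq0 R S2.
  by rewrite /unif; field; rewrite n0.
- move=> x y; rewrite /sever.
  have /negbTE -> : val x \notin S by have := valP x; rewrite finset.in_setC.
  have /negbTE -> : val y \notin S by have := valP y; rewrite finset.in_setC.
  by rewrite andbT.
Qed.

(** A homomorphism into [G] that is lost on deleting the crossing edges
    sends some ordered edge [x y] of [F] to an edge leaving [S]; for fixed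
    [x y] this has probability [cutdens R S]. *)
Lemma sever_error (R : realType) (F G : graph) (S : {set G}) :
  `|t R F G - avg (@unif R G) (fun f : {ffun F -> G} =>
      (relhom (sever S) f)%:R)| <= (#|F| * #|F|)%:R * cutdens R (mem S).
Proof.
rewrite t_avg -avgB.
pose B (a b : G) := (a \in S) && (b \notin S) && adj a b.
pose psi (f : {ffun F -> G}) : R :=
  \sum_(x : F) \sum_(y | adj x y) (B (f x) (f y))%:R.
have sub (f : {ffun F -> G}) : relhom (sever S) f -> relhom (@adj G) f.
  by move=> /relhomP H; apply/relhomP => x y /H /andP[].
have lo (f : {ffun F -> G}) :
    0 <= (relhom (@adj G) f)%:R - (relhom (sever S) f)%:R :> R.
  rewrite subr_ge0 ler_nat; move: (sub f).
  by case: (relhom (sever S) f) => // ->.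
have psi0 (f : {ffun F -> G}) : 0 <= psi f.
  by apply: sumr_ge0 => x _; apply: sumr_ge0.
have hi (f : {ffun F -> G}) :
    (relhom (@adj G) f)%:R - (relhom (sever S) f)%:R <= psi f.
  case: (boolP (relhom (@adj G) f)) => [/relhomP fh|_]; last first.
    by rewrite lerBlDr ler_wpDr // addr_ge0.
  case: (boolP (relhom (sever S) f)) => [_|/relhomP nfh].
    by rewrite subrr.
  rewrite subr0.
  have [x [y [xy Bxy]]] : exists x y, adj x y /\ B (f x) (f y).
    apply: contrapT => noB; apply: nfh => x y xy.
    rewrite /sever fh //=.
    case: (boolP (f x \in S)) => xS; case: (boolP (f y \in S)) => yS //.
      by exfalso; apply: noB; exists x, y; rewrite /B xS yS fh.
    exfalso; apply: noB; exists y, x; rewrite /B xS yS adj_sym; split => //.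
    by rewrite adj_sym fh.
  rewrite /psi (bigD1 x) //= (bigD1 y) //= Bxy -addrA lerDl addr_ge0 //.
    by apply: sumr_ge0.
  by apply: sumr_ge0 => ? _; apply: sumr_ge0.
rewrite ger0_norm; last first.
  rewrite -[leLHS](@avg_cst R G F _ 0 (unif_sum R G)).
  by apply: le_avg => [w|//]; apply: unif_ge0.
apply: (le_trans (le_avg (@unif_ge0 R G) hi)).
rewrite /psi avg_sum.
rewrite [leRHS](_ : _ = \sum_(x : F) \sum_(y : F) cutdens R (mem S)); last first.
  by rewrite mulr_natl !sumr_const -mulrnA.
apply: ler_sum => x _; rewrite avg_sum.
rewrite big_mkcond /=; apply: ler_sum => y _; case: ifP => xy; last exact: cutdens_ge0.
rewrite (@avg_edge R G F _ B x y) ?unif_sum //.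
by apply: contraTneq xy => ->; rewrite adj_irr.
Qed.

(** * The two halves of the theorem *)

Definition balanced (R : realType) (c : R) (G : graph) (A : {set G}) : bool :=
  (c <= vdens R (mem A)) && (c <= vdens R (mem (~: A)%SET)).

Lemma cvg_reindex (R : realType) (f : nat -> R) (phi : nat -> nat) (l : R) :
  (forall m, (m <= phi m)%N) -> f n @[n --> \oo] --> l ->
  f (phi m) @[m --> \oo] --> l.
Proof.
move=> phim fl; apply: (cvg_comp phi f _ fl).
by apply/cvgnyPge => A; exists A => // m /= Am; apply: leq_trans (phim m).
Qed.

(** If it failed, a subsequence would have balanced cuts of density
    tending to 0, and the limits of its two sides would present [Gamma] as a
    direct sum whose weight, the limiting density of one side, lies in
    [[delta, 1 - delta]]. *)
Lemma cuts_of_connected (R : realType) (G : nat -> graph)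
    (Gamma : graph_limit R) (delta : R) :
  converges_to G Gamma -> connected_limit Gamma -> 0 < delta ->
  exists2 eps : R, 0 < eps & \forall n \near \oo, forall A : {set G n},
    balanced delta A -> eps <= cutdens R (mem A).
Proof.
move=> [vG tG] conn d0; apply: contrapT => noeps; apply: conn.
have bad k : exists x : {n : nat & {set G n}},
    [/\ (k <= tag x)%N, balanced delta (tagged x) &
        cutdens R (mem (tagged x)) < k.+1%:R^-1].
  apply: contrapT => nobad; apply: noeps; exists k.+1%:R^-1.
    by rewrite invr_gt0.
  exists k => // n /= kn A bA; rewrite leNgt; apply/negP => cA.
  by apply: nobad; exists (Tagged (fun n => {set G n}) A).
have {noeps} [x xP] := choice bad.
pose H k := G (tag (x k)); pose S k : {set H k} := tagged (x k).
have xk k : (k <= tag (x k))%N by have [] := xP k.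
have bal k : balanced delta (S k) by have [] := xP k.
have cutS k : cutdens R (mem (S k)) < k.+1%:R^-1 by have [] := xP k.
have n0 k : 0 < (v (H k))%:R :> R by rewrite ltr0n vertex_gt0.
have S1 k : (0 < #|S k|)%N.
  have /andP[b _] := bal k; rewrite -(ltr_nat R) vdens_card mulr_gt0 //.
  exact: lt_le_trans b.
have S2 k : (0 < #|(~: S k)%SET|)%N.
  have /andP[_ b] := bal k; rewrite -(ltr_nat R) vdens_card mulr_gt0 //.
  exact: lt_le_trans b.
pose H1 k := induced (S1 k); pose H2 k := induced (S2 k).
(* The sequences to be made convergent together: the proportion of the first
   part and all densities of both parts. *)
pose u (c : option (bool * code)) (k : nat) : R :=
  match c with
  | None => vdens R (mem (S k))
  | Some (true, c) => tcode R c (H1 k)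
  | Some (false, c) => tcode R c (H2 k)
  end.
have u01 c k : 0 <= u c k <= 1.
  case: c => [[[] c]|] /=; try exact: avg_01.
  by rewrite vdens_ge0 vdens_le1.
have [phi [l [phim ul]]] := diagonal_subsequence u01.
have vlarge (T : forall k, {set H k}) :
    (forall k, delta <= vdens R (mem (T k))) ->
    #|T (phi m)| @[m --> \oo] --> \oo.
  move=> dT; apply/cvgnyPge => B.
  (* A host graph with [M] vertices has parts of size at least
     [delta * M >= B]. *)
  pose M := (Num.truncn (B%:R / delta)).+1.
  have MB : B%:R <= delta * M%:R.
    by rewrite -ler_pdivrMl // mulrC ltW // truncnS_gt.
  have /cvgnyPge/(_ M)[K _ HK] := vG.
  exists K => // m /= Km; rewrite -(ler_nat R) vdens_card.
  apply: (le_trans MB); apply: ler_pM => //; first exact: ltW.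
  rewrite ler_nat; apply: HK => /=.
  by apply: leq_trans (xk _); apply: leq_trans (phim m).
have lim1 : exists K : nat -> graph, (v (K n) @[n --> \oo] --> \oo) /\
    (forall F : graph, t R F (K n) @[n --> \oo] --> l (Some (true, code_of F))).
  exists (fun m => H1 (phi m)); split=> [|F].
    under eq_cvg do rewrite v_induced.
    by apply: (vlarge S) => k; have /andP[] := bal k.
  under eq_cvg do rewrite tcodeE; exact: (ul (Some (true, code_of F))).
have lim2 : exists K : nat -> graph, (v (K n) @[n --> \oo] --> \oo) /\
    (forall F : graph, t R F (K n) @[n --> \oo] --> l (Some (false, code_of F))).
  exists (fun m => H2 (phi m)); split=> [|F].
    under eq_cvg do rewrite v_induced.
    by apply: (vlarge (fun k => ~: S k)%SET) => k; have /andP[] := bal k.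
  under eq_cvg do rewrite tcodeE; exact: (ul (Some (false, code_of F))).
exists (GraphLimit lim1), (GraphLimit lim2), (l None).
have dS k : vdens R (mem (S k)) <= 1 - delta.
  have /andP[_ b] := bal k; rewrite lerBrDr -lerBrDl.
  apply: le_trans b _; rewrite -(unif_sum R (H k)) /vdens -sumrB.
  apply: ler_sum => w _; rewrite /= finset.in_setC.
  by case: (w \in _); rewrite ?mulr1 ?mulr0 ?subrr ?subr0.
have lN := ul None.
have l1 : delta <= l None.
  apply: (ler_cvg_to (cvg_cst delta) lN); near=> m.
  by have /andP[] := bal (phi m).
have l2 : l None <= 1 - delta.
  by apply: (ler_cvg_to lN (cvg_cst (1 - delta))); near=> m; apply: dS.
split; first by rewrite (lt_le_trans d0 l1) (le_lt_trans l2) // ltrBlDr ltrDl.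
move=> F Fc /=.
have tF : t R F (H (phi m)) @[m --> \oo] --> tlim Gamma F.
  apply: (@cvg_reindex R (fun k => t R F (G k)) (fun m => tag (x (phi m)))) => // m.
  exact: leq_trans (phim m) (xk _).
have tcut : (#|F| * #|F|)%:R * cutdens R (mem (S (phi m))) @[m --> \oo] --> (0 : R).
  rewrite -[X in _ --> X](mulr0 (#|F| * #|F|)%:R); apply: cvgMl_tmp.
  apply: (@cvg_reindex R (fun k => cutdens R (mem (S k)))) => //.
  apply/cvgrPdist_lt => eps eps0; near=> k.
  rewrite sub0r normrN ger0_norm ?cutdens_ge0 //; apply: lt_trans (cutS k) _.
  by near: k; apply: (near_infty_natSinv_lt (PosNum eps0)).
have tsev : vdens R (mem (S (phi m))) ^+ v F * t R F (H1 (phi m)) +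
    (1 - vdens R (mem (S (phi m)))) ^+ v F * t R F (H2 (phi m))
    @[m --> \oo] --> tlim Gamma F.
  have : t R F (H (phi m)) - (t R F (H (phi m)) -
     avg (@unif R (H (phi m))) (fun f : {ffun F -> H (phi m)} =>
      (relhom (sever (S (phi m))) f)%:R)) @[m --> \oo] --> tlim Gamma F - 0.
    apply: cvgB => //; apply: norm_cvg0.
    apply: (squeeze_cvgr _ (cvg_cst 0) tcut); near=> m.
    by rewrite normr_ge0 sever_error.
  rewrite subr0; apply: cvg_trans; apply: near_eq_cvg; near=> m.
  by rewrite opprB addrCA subrr addr0 (avg_sever R (S1 _) (S2 _)).
apply: (cvg_unique _ tsev) => //.
apply: cvgD; (apply: cvgM; [|under eq_cvg do rewrite tcodeE]).
- exact: continuous_cvg (@exprn_continuous R (v F) _) lN.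
- exact: (ul (Some (true, code_of F))).
- apply: continuous_cvg (@exprn_continuous R (v F) _) _.
  by apply: cvgB => //; apply: cvg_cst.
- exact: (ul (Some (false, code_of F))).
Unshelve. all: by end_near.
Qed.

(** The cuts provided so far depend on the tolerance. Taking for each [n]
    a balanced set of least cut density gives one sequence that meets every
    tolerance eventually. *)
Lemma sparse_cuts_of_disconnected (R : realType) (G : nat -> graph)
    (Gamma : graph_limit R) :
  converges_to G Gamma -> disconnected_limit Gamma ->
  exists2 c : R, 0 < c & exists A : forall n, {set G n},
    (\forall n \near \oo, balanced c (A n)) /\
    (cutdens R (mem (A n)) @[n --> \oo] --> (0 : R)).
Proof.
move=> hG hD; have [c c0 cuts] := disconnected_cuts hG hD.
have opt n : exists A : {set G n}, forall B : {set G n}, balanced c B ->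
    balanced c A /\ cutdens R (mem A) <= cutdens R (mem B).
  case: (pickP (fun A : {set G n} => balanced c A)) => [A0 bA0|none].
    have [A bA minA] := @arg_minP _ R _ A0 (fun A : {set G n} => balanced c A)
      (fun A => cutdens R (mem A)) bA0.
    by exists A => B bB; split => //; apply: minA.
  by exists finset.set0 => B; rewrite none.
exists c => //; exists (fun n => sval (cid (opt n))).
have near_opt (eps : R) : 0 < eps -> \forall n \near \oo,
    balanced c (sval (cid (opt n))) /\ cutdens R (mem (sval (cid (opt n)))) <= eps.
  move=> eps0; near=> n; case: (cid (opt n)) => A minA /=.
  have [B [B1 B2 Beps]] : exists B : {set G n}, [/\ c <= vdens R (mem B),
      c <= vdens R (mem (~: B)%SET) & cutdens R (mem B) <= eps].
    by near: n; apply: cuts.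
  have [|bA AB] := minA B; first by rewrite /balanced B1 B2.
  by split => //; apply: le_trans AB Beps.
split; first by apply: filterS (near_opt 1 ltr01) => n [].
apply/cvgrPdist_le => eps eps0; apply: filterS (near_opt eps eps0) => n [_].
by rewrite sub0r normrN ger0_norm ?cutdens_ge0.
Unshelve. all: by end_near.
Qed.

Unset Implicit Arguments.

Theorem theorem1p10 (R : realType) (G : nat -> graph) (Gamma : graph_limit R)
    (hG : converges_to G Gamma) :
  (connected_limit Gamma ->
    forall delta : R, 0 < delta ->
    exists2 epsilon : R, 0 < epsilon &
    \forall n \near \oo, forall V' V'' : {set G n},
      is_partition V' V'' ->
      delta * (v (G n))%:R <= #|V'|%:R ->
      delta * (v (G n))%:R <= #|V''|%:R ->
      epsilon * (v (G n))%:R ^+ 2 <= (edges_between V' V'')%:R)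
  /\
  (disconnected_limit Gamma ->
    exists2 delta : R, 0 < delta &
    exists V' V'' : forall n, {set G n},
      (\forall n \near \oo,
        [/\ is_partition (V' n) (V'' n),
            delta * (v (G n))%:R <= #|V' n|%:R &
            delta * (v (G n))%:R <= #|V'' n|%:R]) /\
      ((edges_between (V' n) (V'' n))%:R / (v (G n))%:R ^+ 2
         @[n --> \oo] --> (0 : R))).
Proof.
have n0 n : 0 < (v (G n))%:R :> R by rewrite ltr0n vertex_gt0.
split=> [conn delta d0|disc].
  have [eps eps0 cuts] := cuts_of_connected hG conn d0.
  exists eps => //; apply: filterS cuts => n cuts V' V'' VV.
  rewrite (edges_cutdens R VV) (partition_setC VV) !vdens_card.
  rewrite !ler_pM2r ?exprn_gt0 // => b1 b2.
  by apply: cuts; rewrite /balanced b1.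
have [c c0 [A [bA cutA]]] := sparse_cuts_of_disconnected hG disc.
exists c => //; exists A, (fun n => ~: A n)%SET; split.
  apply: filterS bA => n /andP[b1 b2].
  by rewrite setC_partition !vdens_card !ler_pM2r.
apply: cvg_trans cutA; apply: near_eq_cvg; near=> n.
by rewrite (edges_cutdens R (setC_partition _)) mulfK // expf_neq0 // gt_eqF.
Unshelve. all: by end_near.
Qed.
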